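(* Let $(X,\rho)$ be a metric space and let $\mathcal{B}$ be a bornology on $X$ with a closed base. Then $$\psi(\tau_{\mathcal B})=\psi(\tau^s_{\mathcal B})=\Delta(\tau_{\mathcal B})=\Delta(\tau^s_{\mathcal B})=d(X,\mathcal B).$$
   Context: A bornology on a set $X$ is a family $\mathcal B$ of subsets of $X$ that is closed under taking subsets, closed under finite unions, and satisfies $\bigcup\mathcal B=X$. A base of $\mathcal B$ is a subfamily $\mathcal B_0\subset\mathcal B$ such that every $B\in\mathcal B$ is contained in some $B_0\in\mathcal B_0$; $\mathcal B$ has a closed base if it has a base consisting of closed sets (equivalently $\overline B\in\mathcal B$ for all $B\in\mathcal B$). The weak $\mathcal B$-covering number of $X$ is $d(X,\mathcal B)=\aleph_0+\min\{|\gamma|:\gamma\subset\mathcal B,\ \overline{\bigcup\gamma}=X\}$. For $B\subset X$ and $\delta>0$, $B^\delta=\{x\in X:\exists b\in B,\ \rho(x,b)<\delta\}$. $C(X)$ is the set of continuous functions $X\to\mathbb R$. The topology $\tau_{\mathcal B}$ on $C(X)$ is induced by the uniformity with basic entourages $[B,\epsilon]=\{(f,g):\forall x\in B,\ |f(x)-g(x)|<\epsilon\}$, and $\tau^s_{\mathcal B}$ by the uniformity with basic entourages $[B,\epsilon]^s=\{(f,g):\exists\delta>0\ \forall x\in B^\delta,\ |f(x)-g(x)|<\epsilon\}$, where $B\in\mathcal B$, $\epsilon>0$. For a topology $\tau$ on $C(X)$, $\varphi(\tau)$ denotes the cardinal function $\varphi$ of the space $(C(X),\tau)$. Here $\psi$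 is the pseudocharacter (supremum over points $p$ of the least cardinality of a family of open sets with intersection $\{p\}$) and $\Delta$ is the diagonal degree (the least cardinality of a family of open subsets of the square of the space whose intersection is the diagonal). Convention: all cardinal functions are taken to be infinite, i.e. $\aleph_0$ is added to their value. *)

(* Defs.v *)
From HB Require Import structures.
From mathcomp Require Import all_boot all_order all_algebra.
From mathcomp Require Import all_classical all_reals topology normedtype.

Set Implicit Arguments.
Unset Strict Implicit.
Unset Printing Implicit Defensive.

Import Order.TTheory GRing.Theory Num.Theory.
Import numFieldNormedType.Exports.

Local Open Scope classical_set_scope.
Local Open Scope card_scope.
Local Open Scope ring_scope.

(** A cardinal is represented by a set having that cardinality: [#=] and [#<=]
    are equality and comparison of cardinals. *)

(** [least_card P] is a member of [P] of least cardinality. The default value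
    [set0] is taken only when [P] is empty (see [least_cardP]). *)
Definition least_card (U : Type) (P : set (set U)) : set U :=
  xget set0 [set A | P A /\ forall B, P B -> A #<= B].

(** Least upper bound of the cardinals [A i]. As [setT : set U] is an upper
    bound, the least upper bound is the cardinality of some set of type
    [set U]. *)
Definition sup_card (I U : Type) (A : I -> set U) : set U :=
  least_card [set S | forall i, A i #<= S].

(** Cardinal sum of [aleph_0] and [A]. *)
Definition aleph0_add (U : Type) (A : set U) : set (nat + U) :=
  range inl `|` inr @` A.

Lemma least_card_ex (U : Type) (P : set (set U)) : P !=set0 ->
  exists A, P A /\ forall B, P B -> A #<= B.
Proof.
move=> [A0 PA0].
(* Zorn's lemma for sets of selectors that differ at every member of P *)
pose Q (G : set (set U -> U)) :=
  (forall g A, G g -> P A -> A (g A)) /\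
  (forall g h A, G g -> G h -> P A -> g A = h A -> g = h).
have [|G [[Gsel Ginj] Gmax]] := @Zorn_bigcup _ Q.
  move=> F FQ Ftot; split=> [g A [X FX Xg]|g h A [X FX Xg] [Y FY Yh]] PA.
    by have [+ _] := FQ _ FX; move=> /(_ _ _ Xg PA).
  have [XY|YX] := Ftot _ _ FX FY.
    by have [_] := FQ _ FY; move=> /(_ _ _ _ (XY _ Xg) Yh PA).
  by have [_] := FQ _ FX; move=> /(_ _ _ _ Xg (YX _ Yh) PA).
have [[A [PA GA]]|noA] := pselect (exists A, P A /\ A `<=` [set g A | g in G]).
  exists A; split=> // B PB.
  have cG C : P C -> [set g C | g in G] #= G.
    move=> PC; have : {in G &, injective (fun g => g C)}.
      by move=> g h /set_mem Gg /set_mem Gh /(Ginj _ _ _ Gg Gh PC).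
    exact: inj_card_eq.
  apply: card_le_trans (subset_card_le GA) _.
  rewrite (card_le_eql (cG _ PA)) -(card_le_eql (cG _ PB)).
  by apply: subset_card_le => _ [g Gg <-]; exact: (Gsel _ _ Gg PB).
have fresh A : P A -> exists2 a, A a & forall g, G g -> g A <> a.
  move=> PA; apply: contrapT => H; apply: noA; exists A; split=> // a Aa.
  apply: contrapT => Na; apply: H; exists a => // g Gg gA.
  by apply: Na; exists g.
have [u0 _ _] := fresh _ PA0.
have /choice[h hP] A : exists a, P A -> A a /\ forall g, G g -> g A <> a.
  by have [/fresh[a]|] := pselect (P A); [exists a|exists u0].
exfalso; apply: (Gmax (G `|` [set h])).
  split=> [|hG]; first exact: subsetUl.
  by have [_ /(_ h (hG h (or_intror erefl)))] := hP _ PA0.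
split=> [g A [Gg|->] PA|g k A [Gg|->] [Gk|->] PA //].
- exact: (Gsel _ _ Gg PA).
- by have [] := hP _ PA.
- exact: (Ginj _ _ _ Gg Gk PA).
- by have [_ /(_ _ Gg)] := hP _ PA.
- by have [_ /(_ _ Gk)] := hP _ PA => + /esym.
Qed.

Lemma least_cardP (U : Type) (P : set (set U)) : P !=set0 ->
  P (least_card P) /\ forall B, P B -> least_card P #<= B.
Proof. by move=> /least_card_ex; exact: xgetPex. Qed.

Lemma sup_cardP (I U : Type) (A : I -> set U) :
  (forall i, A i #<= sup_card A) /\
  (forall S : set U, (forall i, A i #<= S) -> sup_card A #<= S).
Proof.
apply: (@least_cardP _ [set S | forall i, A i #<= S]).
by exists setT => i; exact: card_leT.
Qed.

Section TopologicalCardinalFunctions.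
Variable T : topologicalType.

Definition pseudocharacter_at (p : T) : set (set T) :=
  least_card [set U : set (set T) |
    U `<=` open /\ \bigcap_(V in U) V = [set p]].

Definition pseudocharacter : set (nat + set T) :=
  aleph0_add (sup_card pseudocharacter_at).

Definition diagonal_degree : set (nat + set (T * T)) :=
  aleph0_add (least_card [set U : set (set (T * T)) |
    U `<=` open /\ \bigcap_(V in U) V = diagonal]).

End TopologicalCardinalFunctions.
Arguments pseudocharacter T : clear implicits.
Arguments diagonal_degree T : clear implicits.

(** [bornology0] is closure under the empty union; it follows from the other
    axioms unless [X] is empty. *)
Record bornology (X : Type) := Bornology {
  bounded : set (set X);
  bornologyS : forall A B, bounded B -> A `<=` B -> bounded A;
  bornology0 : bounded set0;
  bornologyU : forall A B, bounded A -> bounded B -> bounded (A `|` B);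
  bornology_cover : \bigcup_(A in bounded) A = setT
}.

Definition bornology_base (X : Type) (B : bornology X) (B0 : set (set X)) :=
  B0 `<=` bounded B /\ forall A, bounded B A -> exists2 A0, B0 A0 & A `<=` A0.

Definition has_closed_base (X : topologicalType) (B : bornology X) :=
  exists2 B0, bornology_base B B0 & B0 `<=` closed.

Definition weak_covering_number (X : topologicalType) (B : bornology X) :
    set (nat + set X) :=
  aleph0_add (least_card [set G : set (set X) |
    G `<=` bounded B /\ closure (\bigcup_(A in G) A) = setT]).

Section BornologicalUniformities.
Variables (R : realType) (X : metricType R).
Implicit Types (B : bornology X) (A : set X) (e d : R).

Definition enlargement A d : set X := [set x | exists2 b, A b & mdist x b < d].

Local Notation CX := (continuousType X R).

Definition unif_ent A e : set (CX * CX) :=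
  [set fg : CX * CX | forall x, A x -> `|fg.1 x - fg.2 x| < e].

Definition strong_unif_ent A e : set (CX * CX) :=
  [set fg : CX * CX | exists2 d, 0 < d &
    forall x, enlargement A d x -> `|fg.1 x - fg.2 x| < e].

(** The filter with base the sets [E A e], for [A] in [B] and [e > 0]. *)
Definition ent_of B (E : set X -> R -> set (CX * CX)) : set_system (CX * CX) :=
  filter_from [set Ae : set X * R | bounded B Ae.1 /\ 0 < Ae.2]
    (fun Ae => E Ae.1 Ae.2).

Section EntOf.
Variables (B : bornology X) (E : set X -> R -> set (CX * CX)).
Hypothesis Emono : forall A A' e e', A `<=` A' -> e' <= e ->
  E A' e' `<=` E A e.
Hypothesis Erefl : forall A e f, 0 < e -> E A e (f, f).
Hypothesis Esym : forall A e f g, E A e (f, g) -> E A e (g, f).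
Hypothesis Etri : forall A e f g h,
  E A (e / 2) (f, g) -> E A (e / 2) (g, h) -> E A e (f, h).

Lemma ent_of_filter : Filter (ent_of B E).
Proof.
apply: filter_from_filter; first by exists (set0, 1); split => //=; exact: bornology0.
move=> [A e] [A' e'] [/= BA e0] [/= BA' e'0].
exists (A `|` A', Num.min e e'); first by split=> /=; [exact: bornologyU|rewrite lt_min e0].
move=> fg /= H; split; apply: Emono H.
- exact: subsetUl.
- by rewrite ge_min lexx.
- exact: subsetUr.
- by rewrite ge_min lexx orbT.
Qed.

Lemma ent_of_diagonal W : ent_of B E W -> diagonal `<=` W.
Proof. by move=> [[A e] [_ /= e0] EW] [f g] /diagonalP ->; exact/EW/Erefl. Qed.

Lemma ent_of_inv W : ent_of B E W -> ent_of B E W^-1%relation.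
Proof.
by move=> [[A e] Ae EW]; exists (A, e) => // -[f g] /= fg; apply: EW; exact: Esym.
Qed.

Lemma ent_of_split W : ent_of B E W ->
  exists2 V, ent_of B E V & (V \; V `<=` W)%relation.
Proof.
move=> [[A e] [/= BA e0] EW]; exists (E A (e / 2)).
  by exists (A, e / 2) => //; split => //=; rewrite divr_gt0.
by move=> [f h] [g /= fg gh]; apply: EW; exact: Etri fg gh.
Qed.

End EntOf.

Lemma unif_ent_mono A A' e e' : A `<=` A' -> e' <= e ->
  unif_ent A' e' `<=` unif_ent A e.
Proof. by move=> AA' e'e fg H x /AA' /H /lt_le_trans; exact. Qed.

Lemma unif_ent_refl A e f : 0 < e -> unif_ent A e (f, f).
Proof. by move=> e0 x _ /=; rewrite subrr normr0. Qed.

Lemma unif_ent_sym A e f g : unif_ent A e (f, g) -> unif_ent A e (g, f).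
Proof. by move=> H x /H /=; rewrite distrC. Qed.

Lemma unif_ent_tri A e f g h : unif_ent A (e / 2) (f, g) ->
  unif_ent A (e / 2) (g, h) -> unif_ent A e (f, h).
Proof.
move=> fg gh x Ax /=; rewrite [e]splitr.
apply: le_lt_trans (ler_distD (g x) _ _) _.
by apply: ltrD; [exact: fg|exact: gh].
Qed.

Lemma enlargementS A A' d d' : A `<=` A' -> d <= d' ->
  enlargement A d `<=` enlargement A' d'.
Proof. by move=> AA' dd' x [b /AA' A'b xb]; exists b => //; exact: lt_le_trans dd'. Qed.

Lemma strong_unif_ent_mono A A' e e' : A `<=` A' -> e' <= e ->
  strong_unif_ent A' e' `<=` strong_unif_ent A e.
Proof.
move=> AA' e'e fg [d d0 H]; exists d => //.
by move: H; apply: unif_ent_mono => //; exact: enlargementS.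
Qed.

Lemma strong_unif_ent_refl A e f : 0 < e -> strong_unif_ent A e (f, f).
Proof. by move=> e0; exists 1 => //; exact: unif_ent_refl. Qed.

Lemma strong_unif_ent_sym A e f g :
  strong_unif_ent A e (f, g) -> strong_unif_ent A e (g, f).
Proof. by move=> [d d0 H]; exists d => //; exact: unif_ent_sym. Qed.

Lemma strong_unif_ent_tri A e f g h : strong_unif_ent A (e / 2) (f, g) ->
  strong_unif_ent A (e / 2) (g, h) -> strong_unif_ent A e (f, h).
Proof.
move=> [d d0 fg] [d' d'0 gh].
exists (Num.min d d'); first by rewrite lt_min d0.
apply: (@unif_ent_tri _ _ f g h).
- by move: fg; apply: unif_ent_mono => //; apply: enlargementS; rewrite ?ge_min ?lexx.
- by move: gh; apply: unif_ent_mono => //; apply: enlargementS; rewrite ?ge_min ?lexx ?orbT.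
Qed.

(** The spaces (C(X), tau_B) and (C(X), tau^s_B): aliases of
    [continuousType X R] that keep [B] so as to carry their own topology. *)
Definition tau B : Type := CX.
Definition tau_s B : Type := CX.

Section Instances.
Variable B : bornology X.

HB.instance Definition _ := Choice.copy (tau B) CX.
HB.instance Definition _ := isUniform.Build (tau B)
  (ent_of_filter B unif_ent_mono)
  (@ent_of_diagonal B _ unif_ent_refl)
  (@ent_of_inv B _ unif_ent_sym)
  (@ent_of_split B _ unif_ent_tri).

HB.instance Definition _ := Choice.copy (tau_s B) CX.
HB.instance Definition _ := isUniform.Build (tau_s B)
  (ent_of_filter B strong_unif_ent_mono)
  (@ent_of_diagonal B _ strong_unif_ent_refl)
  (@ent_of_inv B _ strong_unif_ent_sym)
  (@ent_of_split B _ strong_unif_ent_tri).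

End Instances.
End BornologicalUniformities.

(* Main.v *)
Require Import Defs.
From mathcomp Require Import all_boot all_order all_algebra.
From mathcomp Require Import all_classical all_reals topology normedtype.

Set Implicit Arguments.
Unset Strict Implicit.
Unset Printing Implicit Defensive.

Import Order.TTheory GRing.Theory Num.Theory.
Import numFieldNormedType.Exports.

Local Open Scope classical_set_scope.
Local Open Scope ring_scope.
Local Open Scope card_scope.

(** If the union of a subfamily [G] of [B] is dense, the entourages [A, 1/n]
    with [A] in [G] meet in the diagonal; hence the diagonal degree is at most
    [d(X, B)], as aleph_0 * |G| is absorbed. Slicing open sets of the square
    shows that the pseudocharacter is at most the diagonal degree. Conversely,
    if open sets [V] meet in the zero function, choose [A_V, e_V]^s inside each
    of them: the union of the [A_V] is dense, since otherwise a nonzero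
    continuous bump vanishing near all the [A_V] would belong to every [V]. *)

(** * Arithmetic of infinite cardinals *)

Lemma inj_in_card_le (T U : Type) (A : set T) (B : set U) (f : T -> U) :
  {in A &, injective f} -> (forall x, A x -> B (f x)) -> A #<= B.
Proof.
move=> finj fAB; rewrite -(card_le_eql (inj_card_eq finj)).
by apply: subset_card_le => _ [x /fAB + <-].
Qed.

Lemma card_le_inj_in (T U : Type) (u : U) (A : set T) (B : set U) :
  A #<= B -> exists2 f : T -> U,
    {in A &, injective f} & forall x, A x -> B (f x).
Proof.
move=> /card_leP[g].
exists (fun x => if pselect (A x) is left Ax then val (g (SigSub (mem_set Ax))) else u).
  move=> x y /set_mem Ax /set_mem Ay.
  case: pselect => // Ax'; case: pselect => // Ay' /val_inj.
  by move=> /(inj (mem_setT _) (mem_setT _)) [].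
by move=> x Ax; case: pselect => // Ax'; exact: set_valP.
Qed.

Lemma aleph0_add_le (U V : Type) (A : set U) (B : set V) :
  A #<= aleph0_add B -> aleph0_add A #<= aleph0_add B.
Proof.
move=> /(card_le_inj_in (inl 0%N))[f finj fB].
(* Absorption of aleph_0: the added copy of [nat] goes to the even numbers, and the elements that
   [f] sends into [nat] go to the odd ones. *)
pose g (x : nat + U) : nat + V := match x with
  | inl n => inl n.*2
  | inr a => match f a with inl n => inl n.*2.+1 | inr b => inr b end
  end.
apply: (@inj_in_card_le _ _ _ _ g) => [x y|_ [[n _ <-]|[a Aa <-]]] /=.
- move=> /set_mem[[n _ <-]|[a Aa <-]] /set_mem[[m _ <-]|[b Ab <-]] /=.
  + by move=> [/double_inj ->].
  + case: (f b) => // k [] /(congr1 odd) /=.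
    by rewrite !odd_double.
  + case: (f a) => // k [] /(congr1 odd) /=.
    by rewrite !odd_double.
  + case fa: (f a) => [k|k]; case fb: (f b) => [l|l] // [].
      move=> /double_inj kl; congr inr; apply: finj; rewrite ?inE//.
      by rewrite fa fb kl.
    move=> kl; congr inr; apply: finj; rewrite ?inE//.
    by rewrite fa fb kl.
- by left; exists n.*2.
- have := fB a Aa; case: (f a) => [n _|b]; first by left; exists n.*2.+1.
  by case=> [[]//|Bb]; right.
Qed.

(* By Zorn's lemma, all but finitely many elements of [A] are covered by
   pairwise disjoint sequences [g]; on the range of [g], multiplication by
   [nat] is absorbed by the index of the sequence. *)
Lemma setX_nat_card_le (U : Type) (A : set U) :
  A `*` [set: nat] #<= aleph0_add A.
Proof.
pose Q (G : set (nat -> U)) := (forall g n, G g -> A (g n)) /\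
  (forall g h m n, G g -> G h -> g m = h n -> g = h /\ m = n).
have [|G [[GA Ginj] Gmax]] := @Zorn_bigcup _ Q.
  move=> F FQ Ftot; split=> [g n [H FH Hg]|g h m n [H FH Hg] [K FK Kh]].
    by have [+ _] := FQ _ FH; exact.
  have [HK|KH] := Ftot _ _ FH FK.
    by have [_] := FQ _ FK; apply => //; exact: HK.
  by have [_] := FQ _ FH; apply => //; exact: KH.
pose C := [set a | exists g n, G g /\ g n = a].
have finC : finite_set (A `\` C).
  (* An injective sequence in an infinite remainder could be added to [G], against maximality. *)
  apply: contrapT => /[dup] /infinite_setN0[u _] /infiniteP /(card_le_inj_in u)[h hinj hAC].
  have hinj' m n : h m = h n -> m = n by apply: hinj; rewrite inE.
  have Gh : ~ G h by move=> Gh; have [_] := hAC 0%N I; apply; exists h, 0%N.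
  apply: (Gmax (G `|` [set h])).
    by split; [exact: subsetUl|move=> /(_ h (or_intror erefl))].
  split=> [g n [/GA//|->]|g k m n [Gg|->] [Gk|->]].
  - by have [] := hAC n I.
  - exact: Ginj.
  - by move=> e; have [_] := hAC n I; case; exists g, m.
  - by move=> e; have [_] := hAC m I; case; exists k, n.
  - by move=> /hinj'.
have : countable ((A `\` C) `*` [set: nat]).
  by apply: countableX => //; exact: finite_set_countable.
move=> /(card_le_inj_in 0%N)[f finj _].
have /choice[k kP] (a : U) : exists gn : (nat -> U) * nat,
    C a -> G gn.1 /\ gn.1 gn.2 = a.
  have [[g [n gn]]|Ca] := pselect (C a); first by exists (g, n).
  by exists (fun=> a, 0%N).
(* With [a] the [n]-th term of its sequence, [(a, m)] goes to the term of index [pickle (n, m)] in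
   the same sequence; pairs over the finite remainder are numbered by [f]. *)
pose F (x : U * nat) : nat + U :=
  if pselect (C x.1) then inr ((k x.1).1 (pickle ((k x.1).2, x.2)))
  else inl (f x).
apply: (@inj_in_card_le _ _ _ _ F) => [[a m] [b n]|[a m] [Aa _]]; last first.
  rewrite /F/=; case: pselect => Ca; last by left; exists (f (a, m)).
  have [Gk _] := kP _ Ca.
  by right; eexists; last reflexivity; exact: GA.
rewrite /F !inE/= => -[/= Aa _] [/= Ab _].
case: pselect => Ca; case: pselect => Cb // [].
  have [Ga ka] := kP _ Ca; have [Gb kb] := kP _ Cb.
  move=> e; have [kk /(pcan_inj pickleK)[kk' ->]] := Ginj _ _ _ _ Ga Gb e.
  by rewrite -ka -kb kk kk'.
by apply: finj; rewrite inE.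
Qed.

Lemma least_card_le (U : Type) (P : set (set U)) (A : set U) :
  P A -> least_card P #<= A.
Proof.
move=> PA; have [|_] := @least_cardP _ P; first by exists A.
exact.
Qed.

(** Copies of [A] and [B] in [T + U] form a two-member family; its least member is below the other
    one. *)
Lemma card_le_total (T U : Type) (A : set T) (B : set U) :
  (A #<= B) || (B #<= A).
Proof.
have inlA : @inl T U @` A #= A.
  by apply: inj_card_eq => ? ? _ _ [].
have inrB : @inr T U @` B #= B.
  by apply: inj_card_eq => ? ? _ _ [].
pose P : set (set (T + U)) := [set inl @` A; inr @` B].
have [|[|] -> leP] := @least_cardP _ P; first by exists (inl @` A); left.
- have := leP _ (or_intror erefl).
  by rewrite (card_le_eql inlA) (card_le_eqr inrB) => ->.
- have := leP _ (or_introl erefl).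
  by rewrite (card_le_eql inrB) (card_le_eqr inlA) orbC => ->.
Qed.

(** [sup_card] is least only among bounds that are sets over [U]. A bound over another type is
    either equipotent to a subset of [U], or at least as large as [U] itself. *)
Lemma sup_card_le (I U V : Type) (A : I -> set U) (S : set V) :
  (forall i, A i #<= S) -> sup_card A #<= S.
Proof.
move=> AS; have [_ supA] := sup_cardP A.
case/orP: (card_le_total S [set: U]) => [/card_subP[S' S'S _]|].
  rewrite -(card_le_eqr S'S); apply: supA => i.
  by rewrite (card_le_eqr S'S).
by apply: card_le_trans; exact: card_leT.
Qed.

Lemma card_le_aleph0_add (U : Type) (A : set U) : A #<= aleph0_add A.
Proof.
by apply: (@inj_in_card_le _ _ _ _ inr) => [? ? _ _ []//|a Aa]; right; exists a.
Qed.

(** * Pseudocharacter and diagonal degree of general spaces *)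

Lemma diagonal_degree_le (T : topologicalType) (U : set (set (T * T))) :
  U `<=` open -> \bigcap_(V in U) V = diagonal ->
  diagonal_degree T #<= aleph0_add U.
Proof.
move=> Uo Ud; apply/aleph0_add_le/(card_le_trans _ (card_le_aleph0_add U)).
exact: least_card_le.
Qed.

Lemma open_slices (T : topologicalType) (U : set (set (T * T))) (p : T) :
  U `<=` open -> \bigcap_(V in U) V = diagonal ->
  exists2 W : set (set T), W #<= U &
    W `<=` open /\ \bigcap_(V in W) V = [set p].
Proof.
move=> Uo Ud; pose slice (V : set (T * T)) := [set q | V (p, q)].
exists (slice @` U); first exact: card_image_le.
split=> [_ [V UV <-]|].
  have pc : continuous (fun q : T => (p, q)).
    by move=> q; apply: cvg_pair; [exact: cvg_cst|exact: cvg_id].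
  by move/continuousP : pc => /(_ _ (Uo _ UV)).
rewrite bigcap_image; apply/seteqP; split=> [q Hq|_ -> V UV] /=.
  by have : diagonal (p, q) by rewrite -Ud => V /Hq.
by have : diagonal (p, p) by []; rewrite -Ud; exact.
Qed.

Lemma pseudocharacter_le (T : topologicalType) (U : set (set (T * T))) :
  U `<=` open -> \bigcap_(V in U) V = diagonal ->
  pseudocharacter T #<= aleph0_add U.
Proof.
move=> Uo Ud; apply/aleph0_add_le/(card_le_trans _ (card_le_aleph0_add U)).
apply: sup_card_le => p; have [W WU Wp] := open_slices p Uo Ud.
by apply: card_le_trans WU; exact: least_card_le.
Qed.

Lemma pseudocharacter_at_le (T : topologicalType) (p : T) :
  pseudocharacter_at p #<= pseudocharacter T.
Proof.
apply: card_le_trans (card_le_aleph0_add _).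
by have [+ _] := sup_cardP (@pseudocharacter_at T); exact.
Qed.

(** Entourages need not be open, so their interiors will serve as open sets of the square. If
    [F \; F] lies in [E], the product of the sections of [F^-1] and [F] at [q] is a neighbourhood of
    [(q, q)] inside [E]. *)
Lemma entourage_diagonal_interior (T : uniformType) (E : set (T * T)) :
  entourage E -> diagonal `<=` E°.
Proof.
move=> entE [p q] /diagonalP ->.
have [F entF FE] := entourage_split_ex entE.
exists (xsection F^-1%relation q, xsection F q).
  by split; apply: nbhs_entourage => //; exact: entourage_inv.
by move=> [x y] /= [/xsectionP xq /xsectionP qy]; apply: FE; exists q.
Qed.

(** * Continuous functions and the weak covering number *)

Section WeakCoveringNumber.
Variables (R : realType) (X : metricType R) (B : bornology X).

Local Notation CX := (continuousType X R).

Lemma mdist_continuous (x : X) : continuous (mdist x : X -> R).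
Proof.
move=> y; apply/cvgrPdist_lt => e e0.
have : \forall z \near y, ball y e z by exact: nbhsx_ballx.
rewrite ballEmdist; apply: filterS => z /=; apply: le_lt_trans.
rewrite ler_distl.
have := metric_triangle x y z; have := metric_triangle x z y.
rewrite (metric_sym z y) -lerBlDr => -> /=.
by rewrite andbT lerBlDr.
Qed.

Lemma bump_ex (x : X) (r : R) : 0 < r ->
  exists2 f : CX, f x != 0 & forall y, r <= mdist x y -> f y = 0.
Proof.
(* Twice the positive part of [r - mdist x y]. *)
move=> r0; pose f y : R := (r - mdist x y) + `|r - mdist x y|.
have dc : continuous (fun y => r - mdist x y).
  by move=> y; apply: cvgB; [exact: cvg_cst|exact: mdist_continuous].
have fc : continuous f.
  by move=> y; apply: cvgD; [exact: dc|apply: cvg_norm; exact: dc].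
exists (mkcts fc) => [|y ry].
  change (f x != 0); rewrite /f mdistxx subr0 gtr0_norm//.
  by rewrite gt_eqF// addr_gt0.
by change (f y = 0); rewrite /f ler0_norm ?subr_le0// addrN.
Qed.

(** Each [V] is only asked to contain a basic strong neighbourhood of zero; this covers both
    topologies, since the uniform neighbourhoods contain the strong ones. *)
Lemma weak_covering_number_le (U : set (set CX)) (f0 : CX) :
  f0 =1 cst 0 ->
  (forall V, U V -> exists2 Ae : set X * R, bounded B Ae.1 /\ 0 < Ae.2 &
    forall f, strong_unif_ent Ae.1 Ae.2 (f0, f) -> V f) ->
  \bigcap_(V in U) V `<=` [set f0] ->
  weak_covering_number B #<= aleph0_add U.
Proof.
move=> f00 Ubase Uf0.
have /choice[Ae AeP] (V : set CX) : exists Ae : set X * R, U V ->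
    [/\ bounded B Ae.1, 0 < Ae.2 &
    forall f, strong_unif_ent Ae.1 Ae.2 (f0, f) -> V f].
  have [/Ubase[Ae [? ?] ?]|] := pselect (U V); first by exists Ae.
  by exists (set0, 0).
apply/aleph0_add_le/(card_le_trans _ (card_le_aleph0_add U)).
apply: card_le_trans (card_image_le (fun V => (Ae V).1) U).
apply: least_card_le; split=> [_ [V /AeP[BV _ _] <-] //|].
rewrite -subTset => x _; apply: contrapT => xG.
have [r r0 xr] : exists2 r, 0 < r & forall y,
    (\bigcup_(A in [set (Ae V).1 | V in U]) A) y -> r <= mdist x y.
  apply: contrapT => H; apply: xG => N /nbhs_ballP[e/= e0 xe].
  apply: contrapT => H'.
  apply: H; exists e => // y Gy; rewrite leNgt; apply/negP => xy.
  by apply: H'; exists y; split => //; apply: xe; rewrite ballEmdist.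
(* Halving [r] leaves room for an enlargement: a point within [r / 2] of both [x] and some [b] in
   [A_V] would put [b] within [r] of [x]. Hence the bump vanishes on the [r / 2]-enlargement of
   every [A_V]. *)
have r20 : 0 < r / 2 by rewrite divr_gt0.
have [f fx f0r] := bump_ex x r20.
suff /esym ff0 : f = f0 by rewrite -ff0 f00 eqxx in fx.
apply: Uf0 => V UV; have [_ e0 VP] := AeP _ UV; apply: VP.
exists (r / 2) => // y [b Ab yb] /=; rewrite f00 f0r ?subrr ?normr0//.
have : r <= mdist x b by apply: xr; exists (Ae V).1 => //; exists V.
move=> /le_trans /(_ (metric_triangle x y b)).
rewrite leNgt => rxb; rewrite leNgt; apply/negP => xy; move: rxb.
by rewrite [r]splitr ltrD.
Qed.

(** On the dense union [|f - g|] is below every [1/(n+1)], hence zero, and the zero set of [f - g]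
    is closed. *)
Lemma unif_ent_diagonal (G : set (set X)) (f g : CX) :
  closure (\bigcup_(A in G) A) = setT ->
  (forall A n, G A -> unif_ent A n.+1%:R^-1 (f, g)) -> f = g.
Proof.
move=> Gd fg; apply/continuousEP => x; apply/eqP; rewrite -subr_eq0.
have hc : continuous (fun y => f y - g y).
  by move=> y; apply: cvgB; exact: cts_fun.
have cl : closed [set y | f y - g y = 0].
  exact: (closed_comp (fun y _ => hc y) (@closed_eq _ (0 : R))).
suff : [set: X] `<=` [set y | f y - g y = 0] by move=> /(_ x I) /= ->.
rewrite -Gd [X in _ `<=` X](closure_id _).1//; apply: closureS => y [A GA Ay] /=.
apply/eqP; rewrite -normr_le0; apply/ler_addgt0Pl => e e0; rewrite addr0.
have [n] := ltr_add_invr e0; rewrite add0r => ne.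
exact/ltW/(lt_trans (fg A n GA y Ay)).
Qed.

(* [phi] identifies [T] with C(X): [T] may be any uniform space whose uniformity
   lies between those of [tau B] and [tau_s B]. *)
Lemma cardinal_functions_between (T : uniformType) (phi : T -> CX) :
  injective phi -> (forall f, exists p, phi p = f) ->
  (forall A e, bounded B A -> 0 < e ->
    entourage [set pq | unif_ent A e (phi pq.1, phi pq.2)]) ->
  (forall V, entourage V -> exists2 Ae : set X * R,
    bounded B Ae.1 /\ 0 < Ae.2 &
    forall p q, strong_unif_ent Ae.1 Ae.2 (phi p, phi q) -> V (p, q)) ->
  pseudocharacter T #= weak_covering_number B /\
  diagonal_degree T #= weak_covering_number B.
Proof.
move=> phi_inj phi_surj ent_unif strong_ent.
pose wc := [set G : set (set X) |
  G `<=` bounded B /\ closure (\bigcup_(A in G) A) = setT].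
have [|[GB Gd] _] := @least_cardP _ wc.
  (* The whole bornology covers [X], so the family minimised by [least_card] is nonempty and its
     default value is not taken. *)
  exists (bounded B); split=> //; rewrite bornology_cover.
  by apply/esym/closure_id; exact: closedT.
set G := least_card wc in GB Gd.
pose E (An : set X * nat) : set (T * T) :=
  [set pq | unif_ent An.1 An.2.+1%:R^-1 (phi pq.1, phi pq.2)].
have Eent An : G An.1 -> entourage (E An).
  by move=> /GB BA; apply: ent_unif => //; rewrite invr_gt0.
pose U := [set (E An)° | An in G `*` [set: nat]].
have Uo : U `<=` open by move=> _ [An _ <-]; exact: open_interior.
have Ud : \bigcap_(V in U) V = diagonal.
  rewrite bigcap_image; apply/seteqP; split=> [[p q] Epq|pq dpq An [GA _]].
    apply/diagonalP/phi_inj/(unif_ent_diagonal Gd) => A n GA.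
    exact: (interior_subset (Epq (A, n) (conj GA I))).
  exact: entourage_diagonal_interior (Eent _ GA) _ dpq.
have UG : aleph0_add U #<= weak_covering_number B.
  apply: aleph0_add_le; apply: card_le_trans (setX_nat_card_le G).
  exact: card_image_le.
have psiG := card_le_trans (pseudocharacter_le Uo Ud) UG.
have DeltaG := card_le_trans (diagonal_degree_le Uo Ud) UG.
have Gpsi : weak_covering_number B #<= pseudocharacter T.
  (* A single point suffices for a lower bound on the supremum: [p] represents the zero function. *)
  have [p phip] := phi_surj (mkcts (@cst_continuous X R 0)).
  have [|[Wo Wp] _] := @least_cardP _ [set W : set (set T) |
      W `<=` open /\ \bigcap_(V in W) V = [set p]].
    by have [W _ Wp] := open_slices p Uo Ud; exists W.
  rewrite -/(pseudocharacter_at p) in Wo Wp.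
  apply: card_le_trans (aleph0_add_le (pseudocharacter_at_le p)).
  set W := pseudocharacter_at p in Wo Wp *.
  (* A smallest family of open sets isolating [p] is transported to C(X), where the bump argument
     applies. *)
  have WW : (fun V => phi @` V) @` W #<= W by exact: card_image_le.
  apply: card_le_trans (aleph0_add_le
    (card_le_trans WW (card_le_aleph0_add W))).
  apply: (@weak_covering_number_le _ (phi p)); first by rewrite phip.
    move=> _ [V WV <-].
    have : nbhs p V.
      apply: open_nbhs_nbhs; split; first exact: Wo.
      by have : [set p] p by []; rewrite -Wp; exact.
    rewrite -nbhs_entourageE => -[F /strong_ent[Ae Ae0 AeF] FV].
    exists Ae => // f; have [q <-] := phi_surj f => /AeF pq.
    by exists q => //; apply: FV; exact/mem_set.
  move=> f Wf; have [q qf] := phi_surj f; rewrite -qf.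
  suff -> : q = p by [].
  suff : [set p] q by []; rewrite -Wp => V WV.
  have [q' Vq'] : (phi @` V) f by apply: Wf; exists V.
  by rewrite -qf => /phi_inj <-.
(* This closes the cycle d(X, B) <= psi <= Delta <= d(X, B). *)
have psiDelta : pseudocharacter T #<= diagonal_degree T.
  have [|[Mo Md] _] := @least_cardP _ [set M : set (set (T * T)) |
      M `<=` open /\ \bigcap_(V in M) V = diagonal]; first by exists U.
  exact: pseudocharacter_le Mo Md.
split; rewrite card_eq_le ?psiG ?DeltaG //=.
exact: card_le_trans psiDelta.
Qed.

End WeakCoveringNumber.

Theorem theorem3p3 (R : realType) (X : metricType R) (B : bornology X)
    (B_closed_base : has_closed_base B) :
  [/\ pseudocharacter (tau B) #= pseudocharacter (tau_s B),
      pseudocharacter (tau_s B) #= diagonal_degree (tau B),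
      diagonal_degree (tau B) #= diagonal_degree (tau_s B) &
      diagonal_degree (tau_s B) #= weak_covering_number B].
Proof.
(* Every enlargement of [A] contains [A], so the uniformity of [tau_s B] refines that of [tau B];
   each of the two is an extreme case of the sandwich lemma, with [phi] the identity. *)
have unif_strong (A : set X) (e : R) :
    strong_unif_ent A e `<=` unif_ent A e.
  move=> fg [d d0 H] x Ax; apply: H; exists x => //.
  by rewrite mdistxx.
have [psi Delta] : pseudocharacter (tau B) #= weak_covering_number B /\
    diagonal_degree (tau B) #= weak_covering_number B.
  apply: (@cardinal_functions_between _ _ _ (tau B) id) => //.
  - by move=> f; exists f.
  - by move=> A e BA e0; exists (A, e).
  - by move=> V [Ae Ae0 AeV]; exists Ae => // p q /unif_strong; exact: AeV.
have [psi_s Delta_s] : pseudocharacter (tau_s B) #= weak_covering_number B /\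
    diagonal_degree (tau_s B) #= weak_covering_number B.
  apply: (@cardinal_functions_between _ _ _ (tau_s B) id) => //.
  - by move=> f; exists f.
  - move=> A e BA e0; exists (A, e) => // -[f g]; exact: unif_strong.
  - by move=> V [Ae Ae0 AeV]; exists Ae => // p q; exact: AeV.
split=> //.
- by rewrite (card_eqr psi_s).
- by rewrite (card_eql psi_s) card_eq_sym.
- by rewrite (card_eqr Delta_s).
Qed.
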